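(* Let $(r_n)_{n\ge 0}$ be a deterministic sequence with $0\le r_n<1$, and let $M=(M_n)_{n\ge 0}$ be a martingale with respect to a filtration $(\mathcal{G}_n)_{n\ge 0}$, taking values in $[0,1]$ and following the dynamics $$M_{n+1}=(1-r_n)M_n+r_nY_{n+1},\qquad n\ge 0,$$ where $Y_{n+1}$ is a random variable with values in $[0,1]$ and $E[Y_{n+1}\mid\mathcal{G}_n]=M_n$ a.s. Let $M_\infty$ be the almost sure limit of $(M_n)_n$. Set $L_\infty=\liminf_{n\to\infty}\mathrm{Var}[Y_{n+1}\mid\mathcal{G}_n]$ and assume $$P\big(\{M_\infty(1-M_\infty)>0\}\cap\{L_\infty=0\}\big)=0.$$ If $\sum_n r_n^2=+\infty$, then $P(M_\infty=0)+P(M_\infty=1)=1$ and $P(M_\infty=1)=E[M_0]$.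
   Context: $\mathrm{Var}[Y_{n+1}\mid\mathcal{G}_n]=E[(Y_{n+1}-E[Y_{n+1}\mid\mathcal{G}_n])^2\mid\mathcal{G}_n]$ denotes the conditional variance. *)

(* Defs.v *)
From HB Require Import structures.
From mathcomp Require Import all_boot all_order all_algebra.
From mathcomp Require Import all_classical all_reals all_analysis.

Set Implicit Arguments.
Unset Strict Implicit.
Unset Printing Implicit Defensive.

Import Order.TTheory GRing.Theory Num.Theory.
Import numFieldNormedType.Exports.

Local Open Scope classical_set_scope.
Local Open Scope ring_scope.

(* Sub-sigma-algebras of the ambient one are represented by their set systems
   [G : set (set T)] on the same carrier, rather than by a second
   [measurableType] structure. *)
Definition sub_sigma_algebra_of (d : measure_display) (T : measurableType d)
    (G : set (set T)) : Prop :=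
  sigma_algebra [set: T] G /\ G `<=` measurable.

Definition filtration (d : measure_display) (T : measurableType d)
    (G : nat -> set (set T)) : Prop :=
  (forall n, sub_sigma_algebra_of (G n)) /\
  (forall m n, (m <= n)%N -> G m `<=` G n).

Definition measurable_wrt (R : realType) (T : Type) (G : set (set T))
    (X : T -> R) : Prop :=
  forall B : set R, measurable B -> G (X @^-1` B).

(* Conditional expectations are determined only up to null sets, so they are
   handled through the predicate "[Z] is a version of E[X | G]". *)
Definition is_cond_exp (d : measure_display) (T : measurableType d)
    (R : realType) (P : probability T R) (G : set (set T))
    (X Z : T -> R) : Prop :=
  [/\ P.-integrable [set: T] (EFin \o X),
      P.-integrable [set: T] (EFin \o Z),
      measurable_wrt G Z &
      forall A, G A ->
        (\int[P]_(w in A) (Z w)%:E = \int[P]_(w in A) (X w)%:E)%E].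

(* [V] is a version of Var[X | G] = E[(X - E[X | G])^2 | G]; the choice of the
   version [Z] of E[X | G] is immaterial. *)
Definition is_cond_var (d : measure_display) (T : measurableType d)
    (R : realType) (P : probability T R) (G : set (set T))
    (X V : T -> R) : Prop :=
  exists2 Z : T -> R, is_cond_exp P G X Z &
    is_cond_exp P G (fun w => (X w - Z w) ^+ 2) V.

Definition martingale (d : measure_display) (T : measurableType d)
    (R : realType) (P : probability T R) (G : nat -> set (set T))
    (M : nat -> T -> R) : Prop :=
  [/\ forall n, measurable_wrt (G n) (M n),
      forall n, P.-integrable [set: T] (EFin \o M n) &
      forall n, is_cond_exp P (G n) (M n.+1) (M n)].

(* Main.v *)
(* Write D_n = Y_{n+1} - M_n, so that M_{n+1} = M_n + r_n D_n. Since M_n is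
   G_n-measurable and E[D_n | G_n] = 0, the cross term vanishes:
   E[M_{n+1}^2] - E[M_n^2] = r_n^2 E[D_n^2] = r_n^2 E[V_n]. Telescoping,
   sum_n r_n^2 E[V_n] <= 1, hence sum_n r_n^2 V_n < oo almost surely; as
   sum_n r_n^2 = oo, this forces liminf V_n = 0 almost surely. By hypothesis
   M_oo (1 - M_oo) > 0 is then a null event, so M_oo is 0 or 1, and
   P(M_oo = 1) = E[M_oo] = E[M_0] by dominated convergence. *)
Require Import Defs.
From HB Require Import structures.
From mathcomp Require Import all_boot all_order all_algebra.
From mathcomp Require Import all_classical all_reals all_analysis.
From mathcomp Require Import measurable_realfun ring lra.
Import Order.TTheory GRing.Theory Num.Theory.
Import numFieldNormedType.Exports.
Local Open Scope classical_set_scope.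
Local Open Scope ring_scope.

Set Implicit Arguments.
Unset Strict Implicit.
Unset Printing Implicit Defensive.

(** * Weighted series and lower limits *)

(** Were the lower limit positive, some tail infimum c would be positive too: then v_k >= c from
    some rank N on, and the convergent series of a_k v_k would dominate c times a divergent tail. *)
Lemma limn_einf_eq0 (R : realType) (a v : nat -> R) :
  (forall n, 0 <= a n) -> (forall n, 0 <= v n) ->
  (\sum_(0 <= n <oo) (a n)%:E = +oo)%E ->
  (\sum_(0 <= n <oo) (a n * v n)%:E < +oo)%E ->
  limn_einf (fun n => (v n)%:E) = 0%E.
Proof.
move=> a0 v0 aoo avoo; set u := fun n => (v n)%:E.
have -> : limn_einf u = ereal_sup (range (einfs u)).
  by rewrite limn_einf_lim; apply/cvg_lim => //; exact: cvg_einfs_sup.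
apply/eqP; rewrite eq_le; apply/andP; split; last first.
  apply: (@le_trans _ _ (einfs u 0%N)); last by apply: ereal_sup_ubound; exists 0%N.
  by apply: le_ereal_inf_tmp => _ [k _ <-]; rewrite lee_fin.
rewrite leNgt; apply/negP => /ereal_sup_gt[_ [N _ <-] e0].
have ev k : (N <= k)%N -> (einfs u N <= (v k)%:E)%E.
  by move=> Nk; apply: ereal_inf_lbound; exists k.
(* The tail infimum is a real number: it is positive and at most [v N]. *)
have [c cE] : exists c, einfs u N = c%:E.
  exists (fine (einfs u N)); rewrite fineK// fin_real// (lt_trans _ e0)//=.
  exact: le_lt_trans (ev _ (leqnn N)) (ltry _).
rewrite cE lte_fin in e0; rewrite {}cE in ev.
(* Removing the first N terms, whose sum is finite, cannot make the series converge. *)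
have aN : (\sum_(N <= n <oo) (a n)%:E = +oo)%E.
  move: aoo; rewrite (@nneseries_split _ _ 0 N)//; last by move=> k _; rewrite lee_fin.
  by rewrite add0n sumEFin; case: (limn _).
suff : (\sum_(N <= n <oo) (c%:E * (a n)%:E) < +oo)%E.
  by rewrite nneseriesZl ?aN ?gt0_muley ?lte_fin ?ltxx// => k _; rewrite lee_fin.
apply: le_lt_trans avoo.
rewrite (@nneseries_split _ _ 0 N)//; last first.
  by move=> k _; rewrite lee_fin mulr_ge0.
rewrite add0n; apply: (@le_trans _ _ (\sum_(N <= n <oo) (a n * v n)%:E)%E).
  apply: lee_lim.
  - by apply: is_cvg_nneseries => k _ _; rewrite lee_fin mulr_ge0// ltW.
  - by apply: is_cvg_nneseries => k _ _; rewrite lee_fin mulr_ge0.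
  apply: nearW => m; rewrite big_nat_cond [leRHS]big_nat_cond.
  apply: lee_sum => k /andP[/andP[Nk _] _].
  by rewrite lee_fin mulrC ler_wpM2l// -lee_fin ev.
by rewrite leeDr// sumEFin lee_fin sumr_ge0// => k _; rewrite mulr_ge0.
Qed.

(** * Measurability with respect to a sub-sigma-algebra *)

(** A sigma-algebra generates itself, so both notions test the same preimages. This gives access to
    the closure properties of [measurable_fun]. *)
Lemma measurable_wrtP (R : realType) (T : pointedType) (G : set (set T))
    (f : T -> R) : sigma_algebra [set: T] G ->
  measurable_wrt G f <-> measurable_fun [set: g_sigma_algebraType G] f.
Proof.
move=> sG; have GE B : (<<s G >> B) = G B by rewrite sigma_algebra_id.
split=> [mf _ B mB|mf B mB].
- by rewrite setTI /measurable/= GE; exact: mf.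
- by have := mf measurableT B mB; rewrite setTI /measurable/= GE.
Qed.

Lemma measurable_wrtB (R : realType) (T : pointedType) (G : set (set T))
    (f g : T -> R) : sigma_algebra [set: T] G ->
  measurable_wrt G f -> measurable_wrt G g ->
  measurable_wrt G (fun w => f w - g w).
Proof.
move=> sG /(measurable_wrtP _ sG) mf /(measurable_wrtP _ sG) mg.
by apply/(measurable_wrtP _ sG); exact: measurable_funB.
Qed.

Lemma measurable_wrt_fun (R : realType) (d : measure_display)
    (T : measurableType d) (G : set (set T)) (f : T -> R) :
  G `<=` measurable -> measurable_wrt G f -> measurable_fun [set: T] f.
Proof. by move=> Gm mf _ B mB; rewrite setTI; exact/Gm/mf. Qed.

(** The sum counts the integers in [1, k] that are at most y, so it is the integer part of y. It
    serves to discretise a bounded function by indicators of its level sets. *)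
Lemma dist_count_le1 (R : realType) (k : nat) (y : R) : 0 <= y <= k%:R ->
  `|y - \sum_(j < k) ((j.+1%:R <= y)%R : nat)%:R| <= 1.
Proof.
elim: k => [|k IH] /andP[y0 yk].
  have -> : y = 0 by apply/eqP; rewrite eq_le y0 yk.
  by rewrite big_ord0 subrr normr0.
have full : k%:R <= y -> \sum_(j < k) ((j.+1%:R <= y)%R : nat)%:R = k%:R :> R.
  move=> ky; rewrite (eq_bigr (fun=> 1)) ?sumr_const ?card_ord// => j _.
  by rewrite (le_trans _ ky)// ler_nat ltn_ord.
rewrite big_ord_recr/=; have [ky|yk1] := leP k.+1%:R y.
  rewrite full; last by rewrite (le_trans _ ky)// ler_nat.
  have -> : y = k.+1%:R by apply/eqP; rewrite eq_le yk ky.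
  by rewrite -natr1 subrr normr0.
rewrite addr0; have [yk'|/ltW ky] := leP y k%:R; first by apply: IH; rewrite y0.
rewrite full// ger0_norm ?subr_ge0// lerBlDl natr1; exact: ltW.
Qed.

(** * Integrals of products with a centred variable *)

Section probability_lemmas.
Context (d : measure_display) (T : measurableType d) (R : realType)
  (P : probability T R).
Implicit Types (G : set (set T)) (f D : T -> R).

Lemma integrable_mul_le1 f D : measurable_fun [set: T] f ->
  (forall w, `|f w| <= 1) -> P.-integrable [set: T] (EFin \o D) ->
  P.-integrable [set: T] (EFin \o (fun w => f w * D w)).
Proof.
move=> mf f1 iD; have mD := measurable_int _ iD.
apply: le_integrable iD => //.
  by apply/measurable_EFinP; apply: measurable_funM => //; exact/measurable_EFinP.
move=> w _ /=; rewrite lee_fin normrM; apply: ler_piMl => //.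
Qed.

Lemma integrable_01 f : measurable_fun [set: T] f ->
  (forall w, 0 <= f w <= 1) -> P.-integrable [set: T] (EFin \o f).
Proof.
move=> mf f01; apply: (@le_integrable _ _ _ P _ measurableT _ (cst 1%:E)).
- exact/measurable_EFinP.
- by move=> w _ /=; rewrite lee_fin normr1 ger0_norm; case/andP: (f01 w).
- exact: finite_measure_integrable_cst.
Qed.

(* [k f] is within 1 of a sum of [k] indicators of events of [G], so
   [k |int f D| <= int |D|] for every [k]. *)
Lemma integral_mul_centered G f D : sub_sigma_algebra_of G ->
  measurable_wrt G f -> (forall w, 0 <= f w <= 1) ->
  P.-integrable [set: T] (EFin \o D) ->
  (forall A, G A -> (\int[P]_(w in A) (D w)%:E = 0)%E) ->
  \int[P]_w (f w * D w) = 0.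
Proof.
move=> [sG Gm] mf f01 iD D0.
have mfT := measurable_wrt_fun Gm mf.
(* Level sets {f >= (j+1)/k} for k > 0; the sum of their indicators is the integer part of k f. *)
pose A k (j : nat) := [set w | j.+1%:R <= k%:R * f w].
have GA k j : G (A k j).
  have -> : A k j = f @^-1` ( *%R k%:R @^-1` `[j.+1%:R, +oo[%classic).
    by apply/seteqP; split=> w /=; rewrite in_itv/= andbT.
  apply: mf; rewrite -[X in measurable X]setTI.
  exact: mulrl_measurable.
pose S k w : R := \sum_(j < k) \1_(A k j) w.
have mS k : measurable_fun setT (S k).
  by apply: measurable_sum => j; apply: measurable_indic; exact/Gm/GA.
have SE k w : S k w = \sum_(j < k) ((j.+1%:R <= k%:R * f w)%R : nat)%:R.
  by apply: eq_bigr => j _; rewrite indicE mem_setE.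
have near k w : `|k%:R * f w - S k w| <= 1.
  rewrite SE; apply: dist_count_le1; have /andP[f0 f1] := f01 w.
  by rewrite mulr_ge0//= ler_piMr.
have iIA k j : P.-integrable setT (EFin \o (fun w => \1_(A k j) w * D w)).
  apply: integrable_mul_le1 => //; first exact/measurable_indic/Gm/GA.
  by move=> w; rewrite indicE; case: (_ \in _); rewrite ?normr1 ?normr0.
have SD k : \int[P]_w (S k w * D w) = 0.
  rewrite /Rintegral (eq_integral (fun w =>
    (\sum_(j < k) (EFin \o (fun w => \1_(A k j) w * D w)%R) w)%E)); last first.
    by move=> w _; rewrite mulr_suml sumEFin.
  rewrite integral_sum// big1 ?fine0// => j _.
  rewrite -[RHS](D0 _ (GA k j)) [RHS]integral_mkcond; apply: eq_integral => w _.
  by rewrite /= patchE indicE; case: (_ \in _); rewrite ?mul1r ?mul0r.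
have ifD : P.-integrable setT (EFin \o (fun w => f w * D w)).
  by apply: integrable_mul_le1 => // w; rewrite ger0_norm; case/andP: (f01 w).
have bound k : k%:R * `|\int[P]_w (f w * D w)| <= \int[P]_w `|D w|.
  have ikS : P.-integrable setT (EFin \o (fun w => (k%:R * f w - S k w) * D w)).
    apply: integrable_mul_le1 => //; apply: measurable_funB => //.
    exact: measurable_funM.
  have iSD : P.-integrable setT (EFin \o (fun w => S k w * D w)).
    have -> : EFin \o (fun w => S k w * D w) =
        (fun w => \sum_(j < k) (EFin \o (fun w => \1_(A k j) w * D w)%R) w)%E.
      by apply/funext => w; rewrite /= mulr_suml sumEFin.
    exact: integrable_sum.
  have -> : k%:R * `|\int[P]_w (f w * D w)|
      = `|\int[P]_w ((k%:R * f w - S k w) * D w)|.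
    (* Subtracting [S k] from k f costs nothing, as [S k * D] has integral 0. *)
    rewrite -[X in X * _]ger0_norm// -normrM -RintegralZl//; congr `| _ |.
    rewrite -[RHS]addr0 -[in RHS](SD k) -RintegralD//.
    by apply: eq_Rintegral => w _; rewrite mulrBl subrK mulrA.
  apply: (le_trans (le_normr_Rintegral _ _)) => //; apply: le_Rintegral => //.
  - exact: (integrable_abse ikS).
  - exact: (integrable_abse iD).
  by move=> w _; rewrite normrM ler_piMl.
apply/eqP; rewrite -normr_eq0; apply/negPn/negP => n0.
have {n0}n0 : 0 < `|\int[P]_w (f w * D w)| by rewrite lt_def n0/=.
(* By the Archimedean property, a k above the ratio of the two integrals contradicts [bound]. *)
have := bound (Num.truncn (\int[P]_w `|D w| / `|\int[P]_w (f w * D w)|)).+1.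
by rewrite leNgt -ltr_pdivrMr// truncnS_gt.
Qed.

(** * Almost sure properties of conditional expectations and variances *)

(** The event N = {D < 0} belongs to G, so it may be used as a test event: the integral of |D| over
    N is minus that of D, hence zero, and D vanishes almost everywhere on N. *)
Lemma ge0_ae G D : sub_sigma_algebra_of G -> measurable_wrt G D ->
  P.-integrable [set: T] (EFin \o D) ->
  (forall A, G A -> (0 <= \int[P]_(w in A) (D w)%:E)%E) ->
  {ae P, forall w, 0 <= D w}.
Proof.
move=> [_ Gm] mD iD D0; pose N := D @^-1` `]-oo, 0[%classic.
have GN : G N by exact: mD.
have mN := Gm _ GN.
have iN : P.-integrable N (EFin \o D) by exact: integrableS iD.
have : (\int[P]_(w in N) `|(EFin \o D) w| = 0)%E.
  apply/eqP; rewrite eq_le integral_ge0 ?andbT => [|*]; last exact: abse_ge0.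
  rewrite (eq_integral (fun w => - (EFin \o D) w)%E); last first.
    move=> w; rewrite inE /N/= in_itv/= => Dw.
    by rewrite ltr0_norm.
  rewrite integralN/=; last exact: integrable_add_def.
  by rewrite leeNl oppe0; exact: D0.
move/(ae_eq_integral_abs P mN (measurable_int _ iN)).
apply: filterS => w /= Dw; rewrite leNgt; apply/negP => Dw0.
have [] : (D w)%:E = 0%E by apply: Dw; rewrite /N/= in_itv.
by move=> D00; rewrite D00 ltxx in Dw0.
Qed.

(** Both versions have the same integral as X over each event of G, so their difference integrates
    to 0 there and [ge0_ae] applies to it. *)
Lemma cond_exp_ae_le G X Z Z' : sub_sigma_algebra_of G ->
  is_cond_exp P G X Z -> is_cond_exp P G X Z' -> {ae P, forall w, Z w <= Z' w}.
Proof.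
move=> sG [iX iZ mZ ZE] [_ iZ' mZ' Z'E].
suff : {ae P, forall w, 0 <= Z' w - Z w}.
  by apply: filterS => w; rewrite subr_ge0.
apply: (ge0_ae sG).
- by apply: measurable_wrtB => //; case: sG.
- exact: (integrableB measurableT iZ' iZ).
move=> A GA; have mA : measurable A by case: sG => _; exact.
under eq_integral do rewrite EFinB.
rewrite integralB_EFin//; [|exact: integrableS iZ'|exact: integrableS iZ].
rewrite ZE// Z'E// subee//.
by apply: (@integrable_fin_num _ _ _ P); last exact: integrableS iX.
Qed.

Lemma cond_exp_ae_eq G X Z Z' : sub_sigma_algebra_of G ->
  is_cond_exp P G X Z -> is_cond_exp P G X Z' -> {ae P, forall w, Z w = Z' w}.
Proof.
move=> sG XZ XZ'; have := cond_exp_ae_le sG XZ XZ'.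
have := cond_exp_ae_le sG XZ' XZ; apply: filterS2 => w h1 h2.
by apply/eqP; rewrite eq_le h1 h2.
Qed.

Lemma cond_var_ge0 G X V : sub_sigma_algebra_of G ->
  is_cond_var P G X V -> {ae P, forall w, 0 <= V w}.
Proof.
move=> sG [Z _ [_ iV mV VE]]; apply: (ge0_ae sG) => // A GA.
by rewrite VE//; apply: integral_ge0 => w _; rewrite lee_fin sqr_ge0.
Qed.

(** The version of the conditional mean hidden in [is_cond_var] agrees almost surely with Z. This
    lets [M n] play the role of the conditional mean of [Y n.+1]. *)
Lemma integral_cond_var G X Z V : sub_sigma_algebra_of G ->
  is_cond_exp P G X Z -> is_cond_var P G X V ->
  (\int[P]_w (V w)%:E = \int[P]_w ((X w - Z w) ^+ 2)%:E)%E.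
Proof.
move=> sG XZ [Z' XZ' [iXZ' _ _ VE]].
have GT : G setT by case: sG => -[G0 GC _] _; rewrite -[setT]setD0; exact: GC.
rewrite VE//; apply: ae_eq_integral => //.
- exact: measurable_int iXZ'.
- case: XZ => iX iZ _ _; apply/measurable_EFinP; apply: measurable_funX.
  by apply: measurable_funB; apply/measurable_EFinP; [exact: measurable_int iX|exact: measurable_int iZ].
by have := cond_exp_ae_eq sG XZ XZ'; apply: filterS => w -> _.
Qed.

Lemma integral_martingale (G : nat -> set (set T)) (M : nat -> T -> R) n :
  filtration G -> martingale P G M ->
  (\int[P]_w (M n w)%:E = \int[P]_w (M 0%N w)%:E)%E.
Proof.
move=> [sG _] [_ _ MM]; elim: n => // n <-; have [_ _ _ <-//] := MM n.
by have [[G0 GC _] _] := sG n; rewrite -[setT]setD0; exact: GC.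
Qed.

End probability_lemmas.

Theorem theorem2p5 (d : measure_display) (T : measurableType d) (R : realType)
    (P : probability T R)
    (r : nat -> R) (hr : forall n, 0 <= r n < 1)
    (G : nat -> set (set T)) (hG : filtration G)
    (M Y : nat -> {RV P >-> R})
    (hM : martingale P G (fun n => M n : T -> R))
    (hM01 : forall n w, 0 <= M n w <= 1)
    (hdyn : forall n w, M n.+1 w = (1 - r n) * M n w + r n * Y n.+1 w)
    (hY01 : forall n w, 0 <= Y n.+1 w <= 1)
    (hYM : forall n, is_cond_exp P (G n) (Y n.+1) (M n))
    (Minf : {RV P >-> R})
    (hMinf : {ae P, forall w, (fun n => M n w) @ \oo --> Minf w})
    (V : nat -> T -> R)
    (hV : forall n, is_cond_var P (G n) (Y n.+1) (V n))
    (hL : P ([set w | 0 < Minf w * (1 - Minf w)] `&`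
             [set w | limn_einf (fun n => (V n w)%:E) = 0%E]) = 0%E)
    (hdiv : (\sum_(0 <= n <oo) (r n ^+ 2)%:E = +oo)%E) :
  (P [set w | Minf w = 0%R] + P [set w | Minf w = 1%R] = 1)%E /\
  P [set w | Minf w = 1] = ('E_P[M 0%N])%E.
Proof.
have sG n : sub_sigma_algebra_of (G n) by case: hG.
have mV n : measurable_fun setT (V n).
  by have [Z _ [_ _ mVn _]] := hV n; apply: measurable_wrt_fun mVn; case: (sG n).
have M2 n w : 0 <= M n w ^+ 2 <= 1.
  by have /andP[M0 M1] := hM01 n w; rewrite sqr_ge0 exprn_ile1.
have iM2 n : P.-integrable setT (EFin \o (fun w => M n w ^+ 2)).
  by apply: integrable_01 => //; exact: measurable_funX.
(* [V n] is nonnegative only almost surely; its positive part is so everywhere, as needed to sum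
   series pointwise, and almost surely equal to it. *)
pose W n w := Num.max (V n w) 0.
have W0 n w : 0 <= W n w by rewrite /W le_max lexx orbT.
have mW n : measurable_fun setT (W n) by exact: measurable_maxr.
have Vge0 : {ae P, forall w, forall n, 0 <= V n w}.
  by apply: ae_foralln => n; exact: cond_var_ge0 (hV n).

(* Increments of the second moments *)
have increment n : (\int[P]_w (r n ^+ 2 * W n w)%:E =
    (\int[P]_w (M n.+1 w ^+ 2) - \int[P]_w (M n w ^+ 2))%:E)%E.
  have [iY iM mM YM] := hYM n.
  have iYM : P.-integrable setT (EFin \o (fun w => Y n.+1 w - M n w)).
    exact: (integrableB measurableT iY iM).
  have iYM2 : P.-integrable setT (EFin \o (fun w => (Y n.+1 w - M n w) ^+ 2)).
    (* The square is [Y n.+1 - M n] times itself, and one factor is bounded by 1 because both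
       variables lie in [0,1]. *)
    have := @integrable_mul_le1 _ _ _ P (fun w => Y n.+1 w - M n w) _ _ _ iYM.
    apply; first exact: measurable_funB.
    move=> w; have /andP[? ?] := hY01 n w; have /andP[? ?] := hM01 n w.
    rewrite ler_norml; lra.
  have iMYM : P.-integrable setT (EFin \o (fun w => M n w * (Y n.+1 w - M n w))).
    apply: integrable_mul_le1 => // w; rewrite ger0_norm; by case/andP: (hM01 n w).
  have MYM0 : \int[P]_w (M n w * (Y n.+1 w - M n w)) = 0.
    apply: (integral_mul_centered (sG n)) => // A GA.
    have mA : measurable A by case: (sG n) => _; exact.
    under eq_integral do rewrite EFinB.
    rewrite integralB_EFin//; [|exact: integrableS iY|exact: integrableS iM].
    rewrite YM// subee//.
    by apply: (@integrable_fin_num _ _ _ P); last exact: integrableS iY.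
  have -> : (\int[P]_w (r n ^+ 2 * W n w)%:E =
      (r n ^+ 2 * \int[P]_w ((Y n.+1 w - M n w) ^+ 2))%:E)%E.
    rewrite -RintegralZl// /Rintegral fineK; last first.
      by apply: (@integrable_fin_num _ _ _ P) => //; exact: integrableZl iYM2.
    have -> : (\int[P]_w (r n ^+ 2 * W n w)%:E =
        (r n ^+ 2)%:E * \int[P]_w (V n w)%:E)%E.
      have [Z _ [_ iV _ _]] := hV n.
      rewrite -integralZl//; apply: ae_eq_integral => //.
      - by apply/measurable_EFinP; exact: measurable_funM.
      - by apply/measurable_EFinP; exact: measurable_funM.
      apply: filterS Vge0 => w Vw _.
      by rewrite /W max_l ?Vw.
    rewrite (integral_cond_var (sG n) (hYM n) (hV n)) -integralZl//.
  congr EFin; apply/esym.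
  rewrite -RintegralB// -RintegralZl//.
  (* Expansion of the square of M_n + r_n (Y_{n+1} - M_n), minus M_n^2; the part linear in r_n is
     the cross term, which integrates to 0. *)
  rewrite (@eq_Rintegral _ _ _ _ _ (fun w => r n ^+ 2 * (Y n.+1 w - M n w) ^+ 2 +
    2 * r n * (M n w * (Y n.+1 w - M n w)))); last first.
    by move=> w _; rewrite hdyn; ring.
  rewrite RintegralD//; [|exact: integrableZl iYM2|exact: integrableZl iMYM].
  by rewrite [X in _ + X]RintegralZl// MYM0 mulr0 addr0.
have mrW n : measurable_fun setT (fun w => (r n ^+ 2 * W n w)%:E).
  by apply/measurable_EFinP; exact: measurable_funM.
have rW0 n w : (0 <= (r n ^+ 2 * W n w)%:E)%E by rewrite lee_fin mulr_ge0 ?sqr_ge0.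

(* Almost sure summability and the lower limit *)
have sumW : {ae P, forall w, (\sum_(0 <= n <oo) (r n ^+ 2 * W n w)%:E < +oo)%E}.
  pose S w := (\sum_(0 <= n <oo) (r n ^+ 2 * W n w)%:E)%E.
  have S0 w : (0 <= S w)%E by apply: nneseries_ge0.
  have iS : P.-integrable setT S.
    apply/integrableP; split; first exact: ge0_emeasurable_sum.
    under eq_integral do rewrite gee0_abs//.
    (* Monotone convergence exchanges sum and integral; the partial sums telescope to E[M_N^2] -
       E[M_0^2], which is at most 1. An integrable function is finite almost everywhere. *)
    rewrite /S integral_nneseries// (@le_lt_trans _ _ 1%E) ?ltry//.
    apply: lime_le.
      by apply: is_cvg_nneseries => n _ _; apply: integral_ge0.
    apply: nearW => N; rewrite (eq_bigr _ (fun n _ => increment n)) sumEFin.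
    rewrite telescope_sumr// lee_fin lerBlDr (@le_trans _ _ 1)//.
      have -> : 1 = \int[P]_w (cst 1 w).
        by rewrite Rintegral_cst// [X in fine X]probability_setT mul1r.
      apply: le_Rintegral => //; first exact: finite_measure_integrable_cst.
      by move=> w _; case/andP: (M2 N w).
    by rewrite lerDl; apply: Rintegral_ge0 => w _; exact: sqr_ge0.
  have := integrable_ae measurableT iS; apply: filterS => w /(_ I).
  by rewrite ge0_fin_numE.
have liminf0 : {ae P, forall w, limn_einf (fun n => (V n w)%:E) = 0%E}.
  apply: filterS2 Vge0 sumW => w Vw Sw.
  have VW : (fun n => V n w) = (fun n => W n w).
    by apply/funext => n; rewrite /W max_l.
  apply: (limn_einf_eq0 (a := fun n => r n ^+ 2) (v := fun n => V n w)) => //.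
    by move=> n; exact: sqr_ge0.
  by under eq_eseriesr => n _ do rewrite (congr1 (fun f => f n) VW).
have mMinf : measurable_fun setT Minf by [].
have mM0 : measurable [set w | Minf w = 0].
  by rewrite -[X in measurable X]setTI; exact: mMinf (measurable_set1 0).
have mM1 : measurable [set w | Minf w = 1].
  by rewrite -[X in measurable X]setTI; exact: mMinf (measurable_set1 1).

(* The limit takes only the values 0 and 1 *)
have noint : {ae P, forall w, ~ (0 < Minf w * (1 - Minf w) /\
    limn_einf (fun n => (V n w)%:E) = 0%E)}.
  (* The null event of [hL] itself is the witness of negligibility, so it remains to show that it is
     measurable. *)
  eexists; split; [|exact: hL|by move=> w /= /contrapT].
  apply: measurableI; rewrite -[X in measurable X]setTI.
    have -> : [set w | 0 < Minf w * (1 - Minf w)] =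
        (fun w => Minf w * (1 - Minf w)) @^-1` `]0, +oo[%classic.
      by apply/seteqP; split=> w /=; rewrite in_itv/= andbT.
    have mMM : measurable_fun setT (fun w => Minf w * (1 - Minf w)).
      by apply: measurable_funM => //; exact: measurable_funB.
    exact: mMM.
  have mlim : measurable_fun setT (fun w => limn_einf (fun n => (V n w)%:E)).
    apply: measurableT_comp => //; apply: measurable_fun_limn_esup => n.
    by apply: measurableT_comp => //; exact/measurable_EFinP.
  exact: mlim (emeasurable_set1 0%E).
have Minf01 : {ae P, forall w, Minf w = 0 \/ Minf w = 1}.
  have := hMinf; apply: filterS3 liminf0 noint => w w0 Nw Mw.
  (* The bounds 0 and 1 pass to the limit; a value strictly between them would put w in the event
     excluded by [noint]. *)
  have L0 : 0 <= Minf w.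
    rewrite -(cvg_lim (@Rhausdorff R) Mw); apply: limr_ge.
      by apply/cvg_ex; exists (Minf w).
    by apply: nearW => n; case/andP: (hM01 n w).
  have L1 : Minf w <= 1.
    rewrite -(cvg_lim (@Rhausdorff R) Mw); apply: limr_le.
      by apply/cvg_ex; exists (Minf w).
    by apply: nearW => n; case/andP: (hM01 n w).
  have [|M0] := eqVneq (Minf w) 0; first by left.
  have [|M1] := eqVneq (Minf w) 1; first by right.
  by case: Nw; rewrite w0; split=> //; rewrite mulr_gt0 ?subr_gt0// lt_def ?M0// eq_sym M1.

(* The two conclusions *)
split.
  rewrite -measureU//; last first.
    by apply/seteqP; split=> // w [/= -> /esym/eqP]; rewrite oner_eq0.
  set A := _ `|` _; have mA : measurable A by exact: measurableU.
  (* The two values are exclusive, so the probabilities add up to that of the union A, whose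
     complement is null. *)
  have PA : (P (~` A) = 0)%E.
    by apply: measure_negligible Minf01; exact: measurableC.
  rewrite -[A]setCK; apply: etrans (probability_setC P (measurableC mA)) _.
  by rewrite [X in (1 - X)%E]PA sube0.
have EM : (\int[P]_w (Minf w)%:E = \int[P]_w (M 0%N w)%:E)%E.
  (* Dominated convergence with the constant bound 1; the expectations of [M n] form a constant
     sequence, so their limit is E[M_0]. *)
  have [|||||_ _ cM] := @dominated_convergence _ _ _ P _ measurableT
    (fun n w => (M n w)%:E) (EFin \o Minf) (cst 1%E).
  - by move=> n; exact/measurable_EFinP.
  - exact/measurable_EFinP.
  - by apply: filterS hMinf => w Mw _; apply: cvg_EFin => //; exact: nearW.
  - exact: finite_measure_integrable_cst.
  - apply: nearW => w n _; rewrite lee_fin ger0_norm; by case/andP: (hM01 n w).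
  move: cM; under eq_fun do rewrite (integral_martingale _ hG hM).
  by move/(cvg_lim (@ereal_hausdorff R)) => <-; rewrite lim_cst.
(* Being 0 or 1 almost surely, [Minf] coincides almost surely with the indicator of {Minf = 1}. *)
rewrite -(expectation_indic P mM1) unlock -EM; apply: ae_eq_integral => //.
- exact/measurable_EFinP/measurable_indic.
- exact/measurable_EFinP.
apply: filterS Minf01 => w + _; rewrite indicE => -[] Mw.
  by rewrite Mw memNset//= Mw => /esym/eqP; rewrite oner_eq0.
by rewrite Mw mem_set.
Qed.
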